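(* Let $I_k,R_k,L_k\ge 1$ be integers, let $n_{k1}<n_{k2}<\dots<n_{kL_k}$ be integers, put $n_{k,\max}=n_{kL_k}$ and let $\mathbf n_k=[\,n_{k,\max}-n_{kL_k},\ n_{k,\max}-n_{k(L_k-1)},\dots,\ n_{k,\max}-n_{k1}\,]^T$ be the delay alignment vector. Let $\mathbf Q_k$ be the $I_kR_k\times(I_k+R_k)$ delay matrix defined in the context. For any such given $\mathbf n_k$, a sufficient condition for the linear system $$\mathbf V_k\mathbf Q_k\boldsymbol x_k=\mathbf n_k$$ to have a solution $\boldsymbol x_k=[\kappa_{k1},\dots,\kappa_{kI_k},\mu_{k1},\dots,\mu_{kR_k}]^T$ for a suitably designed $L_k\times(I_kR_k)$ selection matrix $\mathbf V_k$ is $$I_k+R_k-1\ge L_k .$$ That is, if $I_k+R_k-1\ge L_k$, then there exist a selection matrix $\mathbf V_k$ and a vector $\boldsymbol x_k\in\mathbb R^{I_k+R_k}$ with $\mathbf V_k\mathbf Q_k\boldsymbol x_k=\mathbf n_k$.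
   Context: The index $k$ is a fixed user index. User $k$ has $L_k$ multi-path components with integer delays $n_{k1}<\dots<n_{kL_k}$, $I_k$ pre-compensation delays $\kappa_{k1},\dots,\kappa_{kI_k}$ and $R_k$ post-compensation delays $\mu_{k1},\dots,\mu_{kR_k}$. The matrix $\mathbf Q_k$ collects all sums $\kappa_{ki}+\mu_{kr}$: it is the $I_kR_k\times(I_k+R_k)$ matrix $$\mathbf Q_k=\begin{bmatrix}\mathbf B_1&\mathbf I_{R_k}\\ \mathbf B_2&\mathbf I_{R_k}\\ \vdots&\vdots\\ \mathbf B_{I_k}&\mathbf I_{R_k}\end{bmatrix},$$ where $\mathbf B_i$ is the $R_k\times I_k$ matrix whose $i$-th column is the all-ones vector and whose other entries are zero, and $\mathbf I_{R_k}$ is the $R_k\times R_k$ identity matrix. Thus the entry of $\mathbf Q_k\boldsymbol x_k$ in position $(i-1)R_k+r$ is $\kappa_{ki}+\mu_{kr}$. A selection matrix $\mathbf V_k$ is an $L_k\times(I_kR_k)$ matrix with entries in $\{0,1\}$ such that each row contains exactly one $1$ and each column contains at most one $1$ (it selects $L_k$ distinct rows of $\mathbf Q_k$). *)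

(* Defs.v *)
From mathcomp Require Import all_boot all_order all_algebra.

Set Implicit Arguments.
Unset Strict Implicit.
Unset Printing Implicit Defensive.

Import Order.TTheory GRing.Theory Num.Theory.
Local Open Scope ring_scope.

Lemma sum_ord_const (a b : nat) : (\sum_(i < a) b = a * b)%N.
Proof. by rewrite sum_nat_const card_ord. Qed.

Section DelayAlignment.
Variable R : nzRingType.

Definition ones_col (a b : nat) (i : 'I_a) : 'M[R]_(b, a) :=
  \matrix_(_ < b, j < a) (j == i)%:R.

(* \mxcol has height \sum_(i < a) b, which is equal but not convertible to
   a * b, hence the cast. *)
Definition delay_matrix (a b : nat) : 'M[R]_(a * b, a + b) :=
  castmx (sum_ord_const a b, erefl (a + b)%N)
    (\mxcol_(i < a) row_mx (ones_col b i) (1%:M : 'M[R]_b)).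

Definition selection_matrix (l m : nat) (V : 'M[R]_(l, m)) : Prop :=
  [/\ forall i j, V i j = 0 \/ V i j = 1,
      forall i, #|[set j | V i j == 1%R]| = 1%N
    & forall j, (#|[set i | V i j == 1%R]| <= 1)%N].

(* With 0-based indices, rev_ord (Ordinal hl) is the last index l - 1, where an
   increasing family n attains its maximum, and rev_ord j is l - 1 - j. *)
Definition alignment_vector (l : nat) (hl : (0 < l)%N) (n : 'I_l -> int) :
    'cV[R]_l :=
  \col_(j < l) (n (rev_ord (Ordinal hl)) - n (rev_ord j))%:~R.

Lemma delay_matrixE (a b : nat) (kappa : 'cV[R]_a) (mu : 'cV[R]_b)
    (p : 'I_(a * b)) (i : 'I_a) (r : 'I_b) : p = (i * b + r)%N :> nat ->
  (delay_matrix a b *m col_mx kappa mu) p 0 = kappa i 0 + mu r 0.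
Proof.
move=> pE.
have castE : cast_ord (esym (sum_ord_const a b)) p
    = tagnat.Rank (p_ := fun=> b) i r.
  apply: val_inj; rewrite [RHS]tagnat.RankEsum /= pE; congr (_ + _)%N.
  rewrite sum_nat_const; congr (_ * _)%N.
  have ia : (i <= a)%N := ltnW (ltn_ord i).
  by rewrite -sum1_card -(big_ord_widen a (fun=> 1%N) ia) sum1_card card_ord.
have rowE : row p (delay_matrix a b) = row r (row_mx (ones_col b i) 1%:M).
  rewrite -(mxcolK (fun i => row_mx (ones_col b i) (1%:M : 'M[R]_b)) i).
  by apply/rowP => j; rewrite 3!mxE castmxE castE cast_ord_id.
have -> (A : 'cV[R]_(a * b)) : A p 0 = row p A 0 0 by rewrite mxE.
rewrite row_mul rowE -row_mul mul_row_col mul1mx !mxE; congr (_ + _).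
rewrite (bigD1 i) //= big1 ?addr0 => [|j /negPf ji]; rewrite mxE ?eqxx ?mul1r //.
by rewrite ji mul0r.
Qed.

End DelayAlignment.

(* Main.v *)
(* Select the pairs (kappa_1, mu_r) for all r, then (kappa_i, mu_1) for i > 1.
   In the complete bipartite graph on the kappas and the mus these are the
   I_k + R_k - 1 edges of a spanning tree, so that, once kappa_1 = 0 is fixed,
   each equation determines one new unknown, whatever the right-hand side. *)
Require Import Defs.
From mathcomp Require Import all_boot all_order all_algebra.
From mathcomp Require Import zify.
From mathcomp Require Import reals.

Local Open Scope ring_scope.
Import GRing.Theory.

(** Row [i] is the unit vector at [f i], so injectivity of [f] bounds each column. *)
Lemma selection_matrix_rowsub1 (R : nzRingType) (l m : nat) (f : 'I_l -> 'I_m) :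
  injective f -> selection_matrix (rowsub f (1%:M : 'M[R]_m)).
Proof.
move=> f_inj.
have VE i j : (rowsub f (1%:M : 'M[R]_m) i j == 1) = (f i == j).
  by rewrite !mxE; case: (f i == j); rewrite ?eqxx // eq_sym oner_eq0.
split=> [i j|i|j].
- by rewrite !mxE; case: (f i == j); [right | left].
- apply/eqP/cards1P; exists (f i); apply/setP => j.
  by rewrite !inE VE eq_sym.
- rewrite leqNgt; apply/negP => /card_gt1P[x [y []]].
  by rewrite !inE !VE => /eqP <- /eqP /f_inj ->; rewrite eqxx.
Qed.

Lemma pair_index_subproof (a b : nat) (i : 'I_a) (r : 'I_b) :
  (i * b + r < a * b)%N.
Proof. by have := ltn_ord i; have := ltn_ord r; nia. Qed.

Definition pair_index (a b : nat) (i : 'I_a) (r : 'I_b) : 'I_(a * b) :=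
  Ordinal (pair_index_subproof a b i r).

(** Euclidean division by [b] recovers both indices. *)
Lemma pair_index_inj (a b : nat) (i i' : 'I_a) (r r' : 'I_b) :
  pair_index a b i r = pair_index a b i' r' -> i = i' /\ r = r'.
Proof.
move=> /(congr1 val) /= e; have := ltn_ord r; have := ltn_ord r' => hr' hr.
have b_gt0 : (0 < b)%N by lia.
split; apply: val_inj => /=.
  by move: (congr1 (divn^~ b) e); rewrite /= !divnMDl // !divn_small // !addn0.
by move: (congr1 (modn^~ b) e); rewrite /= !modnMDl !modn_small.
Qed.

Lemma delay_matrix_solvable (R : nzRingType) (a b l : nat) (d : 'cV[R]_l) :
    (0 < a)%N -> (0 < b)%N -> (0 < l)%N -> (l <= a + b - 1)%N ->
  exists V : 'M[R]_(l, a * b), selection_matrix V /\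
    exists x : 'cV[R]_(a + b), V *m delay_matrix R a b *m x = d.
Proof.
case: a => [//|a]; case: b => [//|b]; case: l d => [//|l] d _ _ _ le_l.
(* The truncated difference k - b sends the first b + 1 rows to kappa_1. *)
pose i (k : 'I_l.+1) : 'I_a.+1 := inord (k - b).
pose r (k : 'I_l.+1) : 'I_b.+1 := inord (if (k <= b)%N then k : nat else 0%N).
(* The bound [le_l] gives [k <= a + b], so [k - b] is a valid index and [inord] does not default. *)
have iE k : i k = (k - b)%N :> nat.
  by rewrite inordK //; have := ltn_ord k; lia.
have rE k : r k = (if (k <= b)%N then k : nat else 0%N) :> nat.
  by rewrite inordK //; case: ifP.
pose f k := pair_index a.+1 b.+1 (i k) (r k).
have f_inj : injective f.
  move=> k k' /pair_index_inj[/(congr1 val) /= ik /(congr1 val) /= rk].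
  apply: val_inj => /=; move: ik rk; rewrite !iE !rE.
  (* Rows up to [b] differ in [r]; later ones have a positive [i], which determines [k]. *)
  by case: (leqP k b) => ?; case: (leqP k' b) => ? ? ?; lia.
(* Out of range, [inord] defaults to 0; this only affects unknowns that no selected row contains. *)
pose e (k : nat) := d (inord k) 0.
(* For [j > 0], row [b + j] pairs kappa [j] with mu 0, whose value is [e 0]; hence the
   subtraction. *)
pose kappa : 'cV[R]_a.+1 :=
  \col_(j < a.+1) (if j == 0 :> nat then 0 else e (b + j)%N - e 0%N).
pose mu : 'cV[R]_b.+1 := \col_(j < b.+1) e j.
exists (rowsub f 1%:M); split; first exact: selection_matrix_rowsub1.
exists (col_mx kappa mu); rewrite -mulmxA -rowsubE.
apply/colP => k; rewrite mxE (delay_matrixE _ _ _ (i := i k) (r := r k)) //.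
rewrite !mxE iE rE; case: leqP => kb.
  by rewrite (_ : k - b = 0)%N ?eqxx ?add0r /e ?inord_val //; lia.
(* Now [k > b], so the kappa index is nonzero and the two copies of [e 0] cancel. *)
rewrite ifF; last by apply/negbTE; lia.
by rewrite subrK /e subnKC ?inord_val // ltnW.
Qed.

Theorem theorem1 (R : realType) (I_k R_k L_k : nat)
    (hI : (1 <= I_k)%N) (hR : (1 <= R_k)%N) (hL : (1 <= L_k)%N)
    (n_k : 'I_L_k -> int)
    (n_incr : forall i j : 'I_L_k, (i < j)%N -> n_k i < n_k j)
    (hcond : (L_k <= I_k + R_k - 1)%N) :
  exists V_k : 'M[R]_(L_k, I_k * R_k),
    selection_matrix V_k /\
    exists x_k : 'cV[R]_(I_k + R_k),
      V_k *m delay_matrix R I_k R_k *m x_k = alignment_vector R hL n_k.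
Proof. exact: delay_matrix_solvable. Qed.
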